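(* For every infinite group $G$, the 2-nd Zariski topology $\mathfrak Z_{G^2[x]}$ on $G$ is not discrete.
   Context: Let $G$ be a group with neutral element $1$, and let $G[x]=G*\langle x\rangle$ be the free product of $G$ and the infinite cyclic group generated by an element $x\notin G$. Put $G^0[x]=G$ and $G^{n+1}[x]=G^n[x]\cup\{w\,x\,a,\ w\,x^{-1}a : w\in G^n[x],\ a\in G\}$ for $n\in\{0,1,2,\dots\}$ (monomials of degree $\le n$). Each $w\in G[x]$ defines a map $G\to G$, $g\mapsto w(g)$, where $w(g)$ is the image of $w$ under the homomorphism $G[x]\to G$ that is the identity on $G$ and sends $x$ to $g$. The co-zero set of $w$ is $\mathfrak Z_w=\{g\in G: w(g)\ne 1\}$. For $W\subset G[x]$, $\mathfrak Z_W$ denotes the topology on $G$ generated by the sub-base $\{\mathfrak Z_w: w\in W\}$. The topology $\mathfrak Z_{G^n[x]}$ is called the $n$-th Zariski topology on $G$. *)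

(* Defs.v *)
From HB Require Import structures.
From mathcomp Require Import all_boot all_order all_algebra.
From mathcomp Require Import all_classical topology.

Set Implicit Arguments.
Unset Strict Implicit.
Unset Printing Implicit Defensive.

Local Open Scope classical_set_scope.
Local Open Scope quotient_scope.
Local Open Scope group_scope.

(** Free product of two groups: words in the letters [inl a] ([a : G]) and
    [inr b] ([b : H]), modulo the congruence for concatenation generated by the
    multiplication tables of the two factors. *)
Section FreeProduct.
Variables G H : groupType.

Inductive fp_cong : seq (G + H) -> seq (G + H) -> Prop :=
| fp_refl u : fp_cong u u
| fp_sym u v : fp_cong u v -> fp_cong v u
| fp_trans u v w : fp_cong u v -> fp_cong v w -> fp_cong u w
| fp_cat u u' v v' : fp_cong u u' -> fp_cong v v' -> fp_cong (u ++ v) (u' ++ v')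
| fp_mull (a b : G) : fp_cong [:: inl a; inl b] [:: inl (a * b)]
| fp_mulr (a b : H) : fp_cong [:: inr a; inr b] [:: inr (a * b)]
| fp_onel : fp_cong [:: inl 1] [::]
| fp_oner : fp_cong [:: inr 1] [::].

Definition fp_rel : rel (seq (G + H)) := fun u v => `[< fp_cong u v >].

Fact fp_rel_refl : reflexive fp_rel.
Proof. by move=> u; apply/asboolP; exact: fp_refl. Qed.

Fact fp_rel_sym : symmetric fp_rel.
Proof. by move=> u v; apply/asboolP/asboolP; exact: fp_sym. Qed.

Fact fp_rel_trans : transitive fp_rel.
Proof. by move=> v u w /asboolP uv /asboolP vw; apply/asboolP/(fp_trans uv). Qed.

Canonical fp_equiv := EquivRel fp_rel fp_rel_refl fp_rel_sym fp_rel_trans.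

Definition freeprod := {eq_quot fp_equiv}.

HB.instance Definition _ := Choice.on freeprod.
HB.instance Definition _ := EqQuotient.on freeprod.

Lemma fp_eqP (u v : seq (G + H)) :
  reflect (\pi_freeprod u = \pi_freeprod v) `[< fp_cong u v >].
Proof. exact: (@eqquotP _ fp_rel freeprod). Qed.

Lemma fp_reprK (u : seq (G + H)) : fp_cong (repr (\pi_freeprod u)) u.
Proof. by apply/asboolP/fp_eqP; rewrite reprK. Qed.

Definition fp_mul (p q : freeprod) : freeprod := \pi_freeprod (repr p ++ repr q).

Definition inv_letter (l : G + H) : G + H :=
  match l with inl a => inl a^-1 | inr b => inr b^-1 end.

Definition inv_word (u : seq (G + H)) := rev (map inv_letter u).

Definition fp_inv (p : freeprod) : freeprod := \pi_freeprod (inv_word (repr p)).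

Lemma fp_mul_pi (u v : seq (G + H)) :
  fp_mul (\pi_freeprod u) (\pi_freeprod v) = \pi_freeprod (u ++ v).
Proof. by apply/fp_eqP/asboolP; apply: fp_cat; exact: fp_reprK. Qed.

Lemma fp_cong_mulV (u : seq (G + H)) : fp_cong (u ++ inv_word u) [::].
Proof.
elim: u => [|l u IHu]; first exact: fp_refl.
have lV : fp_cong [:: l; inv_letter l] [::].
  case: l => a /=.
    by apply: fp_trans (fp_mull _ _) _; rewrite mulgV; exact: fp_onel.
  by apply: fp_trans (fp_mulr _ _) _; rewrite mulgV; exact: fp_oner.
rewrite /inv_word /= rev_cons -cats1 catA -cat1s.
apply: fp_trans lV; rewrite -[[:: l; _]]/([:: l] ++ ([::] ++ [:: inv_letter l])).
apply: fp_cat; first exact: fp_refl.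
by apply: fp_cat; [exact: IHu | exact: fp_refl].
Qed.

Lemma inv_wordK : involutive inv_word.
Proof.
move=> u; rewrite /inv_word map_rev revK mapK //.
by case=> a; rewrite /= invgK.
Qed.

Fact fp_mulA : associative fp_mul.
Proof.
elim/quotW=> u; elim/quotW=> v; elim/quotW=> w.
by rewrite (fp_mul_pi v w) (fp_mul_pi u v) !(fp_mul_pi _ w) fp_mul_pi catA.
Qed.

Definition fp_one : freeprod := \pi_freeprod [::].

Fact fp_mul1 : left_id fp_one fp_mul.
Proof. by move=> p; rewrite -[p]reprK fp_mul_pi. Qed.

Fact fp_1mul : right_id fp_one fp_mul.
Proof. by move=> p; rewrite -[p]reprK fp_mul_pi cats0. Qed.

Fact fp_mulV : right_inverse fp_one fp_inv fp_mul.
Proof.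
move=> p; rewrite /fp_inv -{1}[p]reprK fp_mul_pi.
by apply/fp_eqP/asboolP; exact: fp_cong_mulV.
Qed.

Fact fp_Vmul : left_inverse fp_one fp_inv fp_mul.
Proof.
move=> p; rewrite /fp_inv -{2}[p]reprK fp_mul_pi.
apply/fp_eqP/asboolP; rewrite -{2}[repr p]inv_wordK; exact: fp_cong_mulV.
Qed.

HB.instance Definition _ :=
  isGroup.Build freeprod fp_mulA fp_mul1 fp_1mul fp_Vmul fp_mulV.
HB.instance Definition _ := isPointed.Build freeprod 1.

Lemma fp_piM (u v : seq (G + H)) :
  \pi_freeprod (u ++ v) = \pi_freeprod u * \pi_freeprod v :> freeprod.
Proof. by rewrite -fp_mul_pi. Qed.

Definition fp_inl (a : G) : freeprod := \pi_freeprod [:: inl a].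
Definition fp_inr (b : H) : freeprod := \pi_freeprod [:: inr b].

Fact fp_inl_morph : monoid_morphism fp_inl.
Proof.
split=> [|a b]; first by apply/fp_eqP/asboolP; exact: fp_onel.
rewrite [RHS]fp_mul_pi; apply/fp_eqP/asboolP/fp_sym; exact: fp_mull.
Qed.
HB.instance Definition _ := isUMagmaMorphism.Build G freeprod fp_inl fp_inl_morph.

Fact fp_inr_morph : monoid_morphism fp_inr.
Proof.
split=> [|a b]; first by apply/fp_eqP/asboolP; exact: fp_oner.
rewrite [RHS]fp_mul_pi; apply/fp_eqP/asboolP/fp_sym; exact: fp_mulr.
Qed.
HB.instance Definition _ := isUMagmaMorphism.Build H freeprod fp_inr fp_inr_morph.

End FreeProduct.

Arguments fp_inl {G H} a.
Arguments fp_inr {G H} b.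

(** Universal property of the free product. *)
Section Lift.
Variables (G H K : groupType).
Variables (f : UMagmaMorphism.type G K) (g : UMagmaMorphism.type H K).

Definition letter_lift (l : G + H) : K :=
  match l with inl a => f a | inr b => g b end.

Definition fp_lift (p : freeprod G H) : K := \prod_(l <- repr p) letter_lift l.

Lemma fp_cong_lift (u v : seq (G + H)) : fp_cong u v ->
  \prod_(l <- u) letter_lift l = \prod_(l <- v) letter_lift l.
Proof.
elim=> {u v} //.
- by move=> u v w _ -> _ ->.
- by move=> u u' v v' _ uu' _ vv'; rewrite !big_cat /= uu' vv'.
- by move=> a b; rewrite !big_cons !big_nil /= gmulfM !mulg1.
- by move=> a b; rewrite !big_cons !big_nil /= gmulfM !mulg1.
- by rewrite big_cons big_nil /= gmulf1 mulg1.
- by rewrite big_cons big_nil /= gmulf1 mulg1.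
Qed.

Lemma fp_lift_pi (u : seq (G + H)) :
  fp_lift (\pi_(freeprod G H) u) = \prod_(l <- u) letter_lift l.
Proof. exact/fp_cong_lift/fp_reprK. Qed.

Fact fp_lift_morph : monoid_morphism fp_lift.
Proof.
split=> [|p q]; first by rewrite [LHS]fp_lift_pi big_nil.
elim/quotW: p => u; elim/quotW: q => v.
by rewrite -fp_piM !fp_lift_pi big_cat.
Qed.
HB.instance Definition _ :=
  isUMagmaMorphism.Build (freeprod G H) K fp_lift fp_lift_morph.

Lemma fp_lift_inl a : fp_lift (fp_inl a) = f a.
Proof. by rewrite fp_lift_pi big_seq1. Qed.

Lemma fp_lift_inr b : fp_lift (fp_inr b) = g b.
Proof. by rewrite fp_lift_pi big_seq1. Qed.

Lemma fp_lift_unique (h : UMagmaMorphism.type (freeprod G H) K) :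
  (forall a, h (fp_inl a) = f a) -> (forall b, h (fp_inr b) = g b) ->
  h =1 fp_lift.
Proof.
move=> hl hr; elim/quotW; elim=> [|l u IHu].
  by rewrite fp_lift_pi big_nil; exact: gmulf1.
rewrite -cat1s fp_piM !gmulfM IHu; congr (_ * _).
by case: l => c; [rewrite [LHS]hl [RHS]fp_lift_inl|rewrite [LHS]hr [RHS]fp_lift_inr].
Qed.

End Lift.

(** The infinite cyclic group, in multiplicative notation: [n : int] stands for
    the [n]-th power of the generator [1%Z]. *)
Definition infcyclic : Type := int.

HB.instance Definition _ := Choice.on infcyclic.
HB.instance Definition _ := isGroup.Build infcyclic
  (@GRing.addrA int) (@GRing.add0r int) (@GRing.addr0 int)
  (@GRing.addNr int) (@GRing.addrN int).

Definition expgz (G : groupType) (g : G) (n : infcyclic) : G :=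
  match n with Posz k => g ^+ k | Negz k => g ^- k.+1 end.

Section IntegerPowers.
Variables (G : groupType) (g : G).

Lemma expgz_subn (m k : nat) : expgz g (m%:Z - k%:Z)%R = g ^+ m * g ^- k.
Proof.
have [lekm|ltmk] := leqP k m.
  by rewrite subzn //= -{2}(subnK lekm) expgnDr mulgK.
have -> : (m%:Z - k%:Z)%R = Negz (k - m).-1.
  rewrite NegzE prednK ?subn_gt0 //.
  by rewrite -subzn ?(ltnW ltmk) // GRing.opprB.
rewrite /= prednK ?subn_gt0 // -{2}(subnK (ltnW ltmk)) expgnDr.
by rewrite invgM mulVKg.
Qed.

Fact expgz_morph : monoid_morphism (expgz g).
Proof.
have nE (n : int) : exists m k : nat, n = (m%:Z - k%:Z)%R.
  case: n => m; first by exists m, 0%N; rewrite GRing.subr0.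
  by exists 0%N, m.+1; rewrite NegzE GRing.sub0r.
split=> // n n'; have [m [k ->]] := nE n; have [m' [k' ->]] := nE n'.
rewrite -[_ * _ in LHS]/((_ - _) + (_ - _) : int)%R.
rewrite GRing.addrACA -GRing.opprD -!PoszD !expgz_subn expgnDr addnC expgnDr.
rewrite invgM !mulgA; congr (_ * _); rewrite -!mulgA; congr (_ * _).
apply: (mulgI (g ^+ k)); rewrite mulVKg; apply: (mulIg (g ^+ k)).
by rewrite !mulgA mulgVK -!expgnDr addnC.
Qed.
HB.instance Definition _ :=
  isUMagmaMorphism.Build infcyclic G (expgz g) expgz_morph.

End IntegerPowers.

(** [G[x]] is the free product of [G] and the infinite cyclic group; [G] is
    identified with its image under [gconst]. *)
Notation gpoly G := (freeprod G infcyclic).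

Section Zariski.
Variable G : groupType.

Definition gconst : G -> gpoly G := fp_inl.
Definition gX : gpoly G := fp_inr (1%Z : infcyclic).

(** [w(g)]: the image of [w] under the homomorphism [G[x] -> G] that is the
    identity on [G] and sends [x] to [g]. *)
Definition geval (g : G) : gpoly G -> G := fp_lift idfun (expgz g).

HB.instance Definition _ (g : G) := UMagmaMorphism.copy (geval g)
  (fp_lift idfun (expgz g)).

Lemma geval_const g a : geval g (gconst a) = a.
Proof. exact: fp_lift_inl. Qed.

Lemma geval_X g : geval g gX = g.
Proof. exact: fp_lift_inr. Qed.

Lemma geval_unique (g : G) (h : UMagmaMorphism.type (gpoly G) G) :
  (forall a, h (gconst a) = a) -> h gX = g -> h =1 geval g.
Proof.
move=> hG hX; apply: fp_lift_unique => // n.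
have hXn (k : nat) : fp_inr (Posz k : infcyclic) = gX ^+ k :> gpoly G.
  elim: k => [|k IHk]; first exact: (@gmulf1 _ _ (@fp_inr G infcyclic)).
  by rewrite expgS -IHk; exact: (@gmulfM _ _ (@fp_inr G infcyclic) 1%Z (Posz k)).
case: n => k; first by rewrite hXn gmulfXn hX.
have -> : fp_inr (Negz k : infcyclic) = gX ^- k.+1 :> gpoly G.
  rewrite -hXn; exact: (@gmulfV _ _ (@fp_inr G infcyclic) (Posz k.+1)).
by rewrite gmulfXVn hX.
Qed.

Lemma gconst_inj : injective gconst.
Proof. by move=> a b /(congr1 (geval 1)); rewrite !geval_const. Qed.

Lemma gX_notin_const a : gX <> gconst a.
Proof.
move=> /(congr1 (fp_lift (@one_fun G infcyclic) idfun)).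
by rewrite /gX fp_lift_inl fp_lift_inr.
Qed.

Fixpoint monomials (n : nat) : set (gpoly G) :=
  if n is m.+1 then
    monomials m
    `|` [set w * gX * gconst a | w in monomials m & a in [set: G]]
    `|` [set w * gX^-1 * gconst a | w in monomials m & a in [set: G]]
  else range gconst.

Definition cozero (w : gpoly G) : set G := [set g | geval g w <> 1].

(** A copy of [G] carrying the topology generated by the sub-base of the
    co-zero sets of the elements of [W]. *)
Definition zariski (W : set (gpoly G)) : Type := G.

HB.instance Definition _ (W : set (gpoly G)) := Choice.on (zariski W).
HB.instance Definition _ (W : set (gpoly G)) :=
  isSubBaseTopological.Build (zariski W) W cozero.

End Zariski.

Arguments monomials G n : clear implicits.

(* Main.v *)
Require Import Defs.
From mathcomp Require Import all_boot finmap all_classical topology.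

(** If the topology is discrete, then [G \ {1}] is a finite union of zero sets
    [{x | w(x) = 1}] of monomials of degree at most 2 with [w(1) <> 1]. Each of
    them either lies in a coset [g C] of a subgroup [C] with [1 \notin g C] (a
    point, or a coset of a centralizer), or has the form [{x | x b x = c}] with
    [b <> c].

    By B. H. Neumann's lemma the sets covered by finitely many cosets of
    subgroups of infinite index form a proper ideal. Passing to the intersection
    [M] of the subgroups [C] of finite index removes the corresponding cosets, so
    only the sets [{x | x b x = c}] can be large in [M].

    On an infinite abelian subgroup [L] these are also contained in nontrivial
    cosets, of [{h \in L | h b h = b}], which leaves nothing large. An infinite
    FC-centre yields such an [L]. If the FC-centre is finite, pick many elements
    [h] of [M], distinct modulo it: by pigeonhole every [x] outside a small set
    has [h x] and [k x] in the same set [{x | x b x = c}] for some [h <> k],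
    which puts [x] in a coset of a conjugate of the centralizer of [k h^-1],
    a subgroup of infinite index. *)

Set Implicit Arguments.
Unset Strict Implicit.
Unset Printing Implicit Defensive.

Local Open Scope classical_set_scope.
Local Open Scope group_scope.

(** * Subgroups, centralizers and finite index *)

Section Subgroups.
Variable G : groupType.
Implicit Types (A B L M H K S Z : set G) (x y z a b c h k : G).

Definition subgroup H := H 1 /\ forall x y, H x -> H y -> H (x^-1 * y).

Lemma subgroupT : subgroup setT. Proof. by []. Qed.

Lemma subgroup1 : subgroup [set 1].
Proof. by split=> // x y /= -> ->; rewrite mulg1 invg1. Qed.

Lemma subgroupV H x : subgroup H -> H x -> H x^-1.
Proof. by move=> [H1 HM] Hx; rewrite -[x^-1]mulg1; exact: HM. Qed.

Lemma subgroupM H x y : subgroup H -> H x -> H y -> H (x * y).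
Proof.
by move=> sH Hx Hy; rewrite -[x]invgK; apply: sH.2 => //; exact: subgroupV.
Qed.

Lemma subgroupI H K : subgroup H -> subgroup K -> subgroup (H `&` K).
Proof.
by move=> [H1 HM] [K1 KM]; split=> // x y [Hx Kx] [Hy Ky]; split; auto.
Qed.

Definition cent A := [set x | forall a, A a -> commute x a].

Lemma subgroup_cent A : subgroup (cent A).
Proof.
split=> [a _|x y Cx Cy a Aa]; first exact/commute_sym/commute1.
apply/commute_sym/commuteM; last exact/commute_sym/Cy.
exact/commuteV/commute_sym/Cx.
Qed.

(** [H] need not be contained in [L]: this says that [H `&` L] has finite index
    in [L]. *)
Definition fin_index L H :=
  exists F : seq G, forall x, L x -> exists2 f, f \in F & H (f^-1 * x).

Lemma fin_index_sub L H K : H `<=` K -> fin_index L H -> fin_index L K.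
Proof.
by move=> HK [F LF]; exists F => x /LF[f Ff /HK Kx]; exists f.
Qed.

Lemma subgroup_coset H f x y :
  subgroup H -> H (f^-1 * x) -> H (f^-1 * y) -> H (x^-1 * y).
Proof.
by move=> [_ HM] Hx Hy; have := HM _ _ Hx Hy; rewrite invgM invgK mulgA mulgK.
Qed.

(** A coset of [H] and a coset of [K] that meet do so in a coset of the intersection; [p f e] picks
    a common point, and its default 1 is harmless. *)
Lemma fin_indexI L H K : subgroup H -> subgroup K ->
  fin_index L H -> fin_index L K -> fin_index L (H `&` K).
Proof.
move=> sH sK [F LF] [E LE].
pose p f e := xget 1 [set x | H (f^-1 * x) /\ K (e^-1 * x)].
exists [seq p f e | f <- F, e <- E] => x Lx.
have [f Ff Hx] := LF x Lx; have [e Ee Kx] := LE x Lx.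
exists (p f e); first by apply/allpairsP; exists (f, e).
have [Hp Kp] : H (f^-1 * p f e) /\ K (e^-1 * p f e).
  exact: (@xgetPex _ 1 [set x | H (f^-1 * x) /\ K (e^-1 * x)]) (ex_intro _ x _).
by split; [exact: (@subgroup_coset _ f)|exact: (@subgroup_coset _ e)].
Qed.

(** Finitely many translates of the intersection cover [L]. *)
Lemma fin_index_infinite L H : subgroup L -> subgroup H -> infinite_set L ->
  fin_index L H -> infinite_set (L `&` H).
Proof.
move=> sL sH infL [F LF] finI; apply: infL.
pose p f := xget 1 [set x | L x /\ H (f^-1 * x)].
apply: (@sub_finite_set _ _
    (\bigcup_(f in [set` F]) ((fun x => p f * x) @` (L `&` H)))).
  move=> x Lx; have [f Ff Hx] := LF x Lx; exists f => //=.
  have [Lp Hp] : L (p f) /\ H (f^-1 * p f).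
    exact: (@xgetPex _ 1 [set x | L x /\ H (f^-1 * x)]) (ex_intro _ x _).
  exists ((p f)^-1 * x); last by rewrite mulVKg.
  by split; [exact: sL.2|exact: (@subgroup_coset _ f)].
apply: bigcup_finite => [|f _]; first exact: finite_seq.
exact: finite_image.
Qed.

(** If the cosets of [H] in the cover miss some [h] in [L], then [h H `&` L],
    hence every coset of [H `&` L] in [L], is covered by cosets of the other
    subgroups. *)
Lemma neumann L (Hs : seq (set G)) (F : seq G) :
  subgroup L -> {in Hs, forall H, subgroup H} ->
  (forall x, L x -> exists f H, [/\ f \in F, H \in Hs & H (f^-1 * x)]) ->
  exists2 H, H \in Hs & fin_index L H.
Proof.
move=> sL; elim: Hs F => [|H Hs IH] F sHs cover.
  by have [? [? []]] := cover 1 sL.1.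
have sH : subgroup H by apply: sHs; rewrite mem_head.
have [fiH|nfiH] := pselect (fin_index L H); first by exists H; rewrite ?mem_head.
have [h Lh hF] : exists2 h, L h & forall f, f \in F -> ~ H (f^-1 * h).
  apply: contra_notP nfiH => /forall2NP hN; exists F => x Lx.
  by have [//|/existsNP[f /not_implyP[Ff /contrapT Hx]]] := hN x; exists f.
pose p f := xget 1 [set x | L x /\ H (f^-1 * x)].
(* When [f H] meets [L], left translation by [p f * h^-1] carries the part of [h H] in [L] onto the
   part of [f H] in [L]. *)
have [K HsK|x Lx|K HsK fiK] := IH (F ++ [seq p f * h^-1 * g | f <- F, g <- F]).
- by apply: sHs; rewrite inE HsK orbT.
- have [f [K [Ff]]] := cover x Lx; rewrite inE => /predU1P[-> {K} Hx|HsK Kx]; last first.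
    by exists f, K; rewrite mem_cat Ff.
  have [Lp Hp] : L (p f) /\ H (f^-1 * p f).
    exact: (@xgetPex _ 1 [set x | L x /\ H (f^-1 * x)]) (ex_intro _ x _).
  have Hpx : H ((p f)^-1 * x) by exact: (@subgroup_coset _ f).
  have Lhpx : L (h * ((p f)^-1 * x)) by apply: subgroupM => //; exact: sL.2.
  have [g [K [Fg]]] := cover _ Lhpx.
  rewrite inE => /predU1P[-> Hg|HsK Kg].
    case: (hF g Fg); have := subgroupM sH Hg (subgroupV sH Hpx).
    by rewrite -mulgA mulgK.
  exists (p f * h^-1 * g), K; split=> //.
    by rewrite mem_cat orbC; apply/orP; left; apply/allpairsP; exists (f, g).
  by rewrite !invgM invgK -!mulgA.
- by exists K; rewrite // inE HsK orbT.
Qed.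

(** * The ideal of small sets *)

(** The left-invariant ideal of sets covered by finitely many left cosets of
    subgroups of infinite index in [L]. *)
Definition small L A := exists2 F : seq (G * set G),
  {in F, forall p, subgroup p.2 /\ ~ fin_index L p.2} &
  forall x, A x -> exists2 p, p \in F & p.2 (p.1^-1 * x).

(** Otherwise Neumann's lemma would give one of the covering subgroups finite index in [L]. *)
Lemma small_full L : subgroup L -> ~ small L L.
Proof.
move=> sL [F FP LF].
have [H /mapP[p Fp ->]|x Lx|H /mapP[p Fp ->] HL] :=
    @neumann L (map snd F) (map fst F) sL.
- by case: (FP p Fp).
- have [p Fp px] := LF x Lx.
  by exists p.1, p.2; split; rewrite ?(map_f fst Fp) ?(map_f snd Fp).
- by case: (FP p Fp).
Qed.

Lemma small_sub L A B : A `<=` B -> small L B -> small L A.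
Proof. by move=> AB [F FP BF]; exists F => // x /AB/BF. Qed.

Lemma small0 L : small L set0. Proof. by exists [::]. Qed.

Lemma smallU L A B : small L A -> small L B -> small L (A `|` B).
Proof.
move=> [F FP AF] [E EP BE]; exists (F ++ E).
  by move=> p; rewrite mem_cat => /orP[/FP|/EP].
by move=> x [/AF|/BE] [p pF px]; exists p; rewrite // mem_cat pF ?orbT.
Qed.

Lemma small_bigcup L (T : eqType) (s : seq T) (A : T -> set G) :
  {in s, forall i, small L (A i)} -> small L (\bigcup_(i in [set` s]) A i).
Proof.
elim: s => [|i s IHs] sA.
  by apply: small_sub (small0 L) => x [i].
apply: small_sub (smallU (sA i (mem_head _ _)) (IHs _)) => [x [j /=]|j js].
  by rewrite inE => /predU1P[->|js] Ax; [left|right; exists j].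
by apply: sA; rewrite inE js orbT.
Qed.

Lemma small_coset L H A : subgroup H -> ~ fin_index L H ->
  (forall x y, A x -> A y -> H (x^-1 * y)) -> small L A.
Proof.
move=> sH nfi AH; have [[x Ax]|A0] := pselect (A !=set0).
  exists [:: (x, H)] => [p|y Ay]; first by rewrite inE => /eqP->.
  by exists (x, H); rewrite ?mem_head //=; exact: AH.
by apply: small_sub (small0 L) => x Ax; case: A0; exists x.
Qed.

Lemma small_translate L A h : small L A -> small L [set x | A (h * x)].
Proof.
move=> [F FP AF]; exists [seq (h^-1 * p.1, p.2) | p <- F].
  by move=> _ /mapP[p Fp ->] /=; exact: FP.
move=> x /AF[p Fp px]; exists (h^-1 * p.1, p.2); first by apply/mapP; exists p.
by rewrite /= invgM invgK -mulgA.
Qed.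

Lemma small_fin_index L M : subgroup L -> fin_index L M -> ~ small L M.
Proof.
move=> sL [F LF] sM; apply: (small_full sL).
apply: small_sub (@small_bigcup L _ F (fun f => [set x | M (f^-1 * x)]) _).
  by move=> x /LF[f Ff Mx]; exists f.
by move=> f _; exact: small_translate.
Qed.

Lemma small1 L : infinite_set L -> small L [set 1].
Proof.
move=> infL; apply: (small_coset subgroup1); last first.
  by move=> x y /= -> ->; rewrite mulg1 invg1.
move=> [F LF]; apply: infL; apply: sub_finite_set (finite_seq F) => x /LF[f Ff].
by move=> /= /mulg1_eq <-; rewrite invgK.
Qed.


(** * The FC-centre: the elements with finitely many conjugates *)

Definition FC := [set a | fin_index setT (cent [set a])].

Lemma cent1P a x : cent [set a] x <-> commute x a.
Proof. by split=> [|xa b ->//]; apply. Qed.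

Lemma FC_conj a b : FC a -> FC (b * a * b^-1).
Proof.
move=> [F FP]; exists [seq b * f * b^-1 | f <- F] => x _.
have [//|f Ff /cent1P fa] := FP (b^-1 * x * b).
exists (b * f * b^-1); first exact: map_f.
apply/cent1P; rewrite /commute in fa *.
apply: (@mulgI _ b^-1); apply: (@mulIg _ b).
by move: fa; rewrite !invgM !invgK !mulgA mulVg !mul1g !mulgVK.
Qed.

Lemma subgroup_FC : subgroup FC.
Proof.
split=> [|x y FCx FCy].
  by exists [:: 1] => x _; exists 1; rewrite ?mem_head //; apply/cent1P/commute1.
have := fin_indexI (subgroup_cent [set x]) (subgroup_cent [set y]) FCx FCy.
apply: fin_index_sub => z [/cent1P zx /cent1P zy]; apply/cent1P.
exact/commuteM/zy/commuteV.
Qed.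

Lemma fin_index_cent (s : seq G) : {in s, forall a, FC a} ->
  fin_index setT (cent [set` s]).
Proof.
elim: s => [|a s IHs] sFC.
  by exists [:: 1] => x _; exists 1 => [|a]; rewrite /= ?mem_head ?in_nil.
have fis : fin_index setT (cent [set` s]).
  by apply: IHs => b bs; apply: sFC; rewrite inE bs orbT.
have := fin_indexI (subgroup_cent [set a]) (subgroup_cent [set` s])
  (sFC a (mem_head _ _)) fis.
apply: fin_index_sub => z [/cent1P za zs] b.
by rewrite /= inE => /predU1P[->//|/zs].
Qed.

(** A maximal commuting subset of an infinite FC-centre cannot be finite, as its
    centralizer would have finite index; its double centralizer is abelian. *)
Lemma FC_infinite_abelian : infinite_set FC ->
  exists L, [/\ subgroup L, infinite_set L &
                forall x y, L x -> L y -> commute x y].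
Proof.
move=> infFC.
have [|A [[AFC cA] maxA]] := @Zorn_bigcup G
    [set A | A `<=` FC /\ forall x y, A x -> A y -> commute x y].
  move=> F FP Ftot; split=> [x [A FA Ax]|x y [A FA Ax] [B FB By]].
    exact: (FP A FA).1.
  have [AB|BA] := Ftot A B FA FB.
    by apply: (FP B FB).2 => //; exact: AB.
  by apply: (FP A FA).2 => //; exact: BA.
have infA : infinite_set A.
  move=> finA; have [s As] := (finite_seqP _).1 finA.
  have fiC : fin_index FC (cent A).
    have [|F FP] := @fin_index_cent s; last first.
      by rewrite As; exists F => x _; exact: FP.
    by move=> a sa; apply: AFC; rewrite As.
  (* The part of [cent A] in [FC] is thus infinite, while maximality puts it inside the finite set
     [A]. *)
  apply: (fin_index_infinite subgroup_FC (subgroup_cent A) infFC fiC).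
  apply: sub_finite_set finA => y [FCy Cy]; apply: contrapT => nAy.
  apply: (maxA (y |` A)).
    by split=> [x Ax|]; [right|move=> /(_ y (or_introl erefl))].
  split=> [x [->//|/AFC//]|x z [->|Ax] [->|Az]]; [|exact: Cy| |exact: cA] => //.
  exact/commute_sym/Cy.
have sAC : A `<=` cent (cent A) by move=> a Aa b Cb; exact/commute_sym/Cb.
have sCA : cent (cent A) `<=` cent A.
  by move=> x Cx a Aa; apply: Cx => b Ab; exact: cA.
exists (cent (cent A)); split; first exact: subgroup_cent.
  exact: sub_infinite_set sAC infA.
by move=> x y Cx Cy; apply: Cx; exact: sCA.
Qed.

(** * Proper cosets and square-root sets *)

(** Within [L], the set [Z] lies in a coset of a subgroup [H] other than [H]. *)
Definition proper_coset L Z := exists H, [/\ subgroup H,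
  forall x y, L x -> L y -> Z x -> Z y -> H (x^-1 * y) &
  forall x, L x -> Z x -> ~ H x].

(** The condition [b <> c] says that 1 does not solve [x * b * x = c]. *)
Definition square_root_set Z :=
  exists b c, b <> c /\ forall x, Z x -> x * b * x = c.

(** If [H] has finite index, cutting [M] down to [H] removes [Z] altogether; if not, [Z] is small
    within [L] already. *)
Lemma proper_coset_small L (Zs : seq (set G)) : subgroup L ->
  {in Zs, forall Z, proper_coset L Z} ->
  exists M, [/\ subgroup M, M `<=` L, fin_index L M &
                {in Zs, forall Z, small L (M `&` Z)}].
Proof.
move=> sL; elim: Zs => [|Z Zs IH] ZsP.
  exists L; split=> //.
  by exists [:: 1] => x Lx; exists 1; rewrite ?mem_head // invg1 mul1g.
have [|M [sM ML fiM smM]] := IH.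
  by move=> Y YZs; apply: ZsP; rewrite inE YZs orbT.
have [H [sH ZH ZNH]] := ZsP Z (mem_head _ _).
have [fiH|nfiH] := pselect (fin_index L H).
  exists (M `&` H); split; first exact: subgroupI.
  - by move=> x [/ML].
  - exact: fin_indexI.
  - move=> Y; rewrite inE => /predU1P[->|/smM].
      by apply: small_sub (small0 L) => x [[/ML Lx Hx] Zx]; case: (ZNH x).
    by apply: small_sub => x [[]].
exists M; split=> // Y; rewrite inE => /predU1P[->|/smM//].
by apply: (small_coset sH nfiH) => x y [/ML Lx Zx] [/ML Ly Zy]; exact: ZH.
Qed.

Lemma square_root_set_abelian L Z : subgroup L ->
  (forall x y, L x -> L y -> commute x y) ->
  square_root_set Z -> proper_coset L Z.
Proof.
(* With [z = b] this makes the solutions of [h * b * h = b] in [L] a subgroup; with [z = c] it puts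
   [Z] in one of its cosets. *)
move=> sL cL [b [c [bc Zc]]]; have key x y z : L x -> L y -> x * b * x = z -> y * b * y = z ->
    x^-1 * y * b * (x^-1 * y) = b.
  move=> Lx Ly xz yz; have e : x^-1 * y = y * x^-1 by exact/commute_sym/commuteV/cL.
  rewrite {2}e; transitivity (x^-1 * (y * b * y) * x^-1); first by rewrite !mulgA.
  by rewrite yz -xz !mulgA mulVg mul1g mulgK.
exists (L `&` [set h | h * b * h = b]).
split=> [|x y Lx Ly /Zc xc /Zc yc|x Lx /Zc xc [_ /= xb]].
- split=> [|x y [Lx /= xb] [Ly /= yb]].
    by split; [exact: sL.1|rewrite /= mul1g mulg1].
  by split; [exact: sL.2|exact: key yb].
- by split; [exact: sL.2|exact: key yc].
- by apply: bc; rewrite -xb.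
Qed.

Lemma no_abelian_cover L (Zs : seq (set G)) : subgroup L -> infinite_set L ->
  (forall x y, L x -> L y -> commute x y) ->
  {in Zs, forall Z, proper_coset setT Z \/ square_root_set Z} ->
  ~ (forall x, x <> 1 -> exists2 Z, Z \in Zs & Z x).
Proof.
move=> sL infL cL ZsP cover.
have [|M [sM ML fiM smM]] := @proper_coset_small L Zs sL.
  move=> Z /ZsP[[H [sH ZH ZNH]]|]; last exact: square_root_set_abelian.
  by exists H; split=> // [x y _ _|x _]; [exact: ZH|exact: ZNH].
apply: (small_fin_index sL fiM).
apply: small_sub (smallU (small1 infL) (small_bigcup smM)) => x Mx.
have [->|/eqP/cover[Z ZZs Zx]] := eqVneq x 1; [by left|by right; exists Z].
Qed.

(** * Covers when the FC-centre is finite *)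

Lemma commute_conjugators x y d e :
  x * d = e * x -> y * d = e * y -> commute (x^-1 * y) d.
Proof.
by move=> xd yd; apply: (@mulgI _ x); rewrite -mulgA mulVKg yd mulgA xd
  !mulgA mulgK.
Qed.

(** Comparing the two equations shows that [h * x * b] conjugates [a = k * h^-1] to its inverse.
    Hence [x] conjugates [b * a * b^-1] to a fixed element, which confines it to one coset of a
    centralizer. *)
Lemma square_root_set_small Z h k : square_root_set Z -> ~ FC (k * h^-1) ->
  small setT [set x | Z (h * x) /\ Z (k * x)].
Proof.
move=> [b [c [_ Zc]]]; set a := k * h^-1 => aFC.
have aP x : Z (h * x) -> Z (k * x) -> a * (h * x * b) * a = h * x * b.
  move=> /Zc hc /Zc; rewrite -hc -(mulgVK h k) -/a => e.
  by apply: (@mulIg _ (h * x)); rewrite -e !mulgA.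
apply: (@small_coset _ (cent [set b * a * b^-1])).
- exact: subgroup_cent.
- move=> fi; apply: aFC; have := @FC_conj _ b^-1 fi.
  by rewrite invgK !mulgA mulVg mul1g mulgVK.
move=> x y /= [hx kx] [hy ky]; apply/cent1P.
have P z : Z (h * z) -> Z (k * z) -> z * (b * a * b^-1) = h^-1 * a^-1 * h * z.
  move=> hz kz; apply: (@mulIg _ b); apply: (@mulgI _ h); apply: (@mulgI _ a).
  have := aP z hz kz; rewrite !mulgA mulgVK => ->.
  by rewrite !mulgK mulgV mul1g.
exact: commute_conjugators (P x hx kx) (P y hy ky).
Qed.

Lemma FC_transversal M (n : nat) : infinite_set M -> finite_set FC ->
  exists hs : seq G, [/\ uniq hs, size hs = n, {in hs, forall h, M h} &
    {in hs &, forall h k, h != k -> ~ FC (k * h^-1)}].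
Proof.
move=> infM finFC; elim: n => [|n [hs [Uhs shs hsM hsFC]]]; first by exists [::].
pose B := \bigcup_(h in [set` hs]) ((fun x => x * h) @` FC).
have [k Mk Bk] : exists2 k, M k & ~ B k.
  apply: contra_notP infM => /forall2NP MB.
  apply: (@sub_finite_set _ _ B) => [x Mx|].
    by have [//|/contrapT] := MB x.
  apply: bigcup_finite => [|h _]; first exact: finite_seq.
  exact: finite_image.
have kFC h : h \in hs -> ~ FC (k * h^-1).
  by move=> hhs FCk; apply: Bk; exists h => //; exists (k * h^-1); rewrite ?mulgVK.
exists (k :: hs); split=> /=; rewrite ?shs ?Uhs ?andbT //.
- by apply/negP => /kFC; apply; rewrite mulgV; exact: subgroup_FC.1.
- by move=> h; rewrite inE => /predU1P[->//|/hsM].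
- move=> h l; rewrite !inE => /predU1P[->|hhs] /predU1P[->|lhs] //.
  + by rewrite eqxx.
  + move=> _ /(subgroupV subgroup_FC); rewrite invgM invgK; exact: kFC.
  + by move=> _; exact: kFC.
  + exact: hsFC.
Qed.

Lemma no_FC_cover (Zs : seq (set G)) : infinite_set [set: G] -> finite_set FC ->
  {in Zs, forall Z, proper_coset setT Z \/ square_root_set Z} ->
  ~ (forall x, x <> 1 -> exists2 Z, Z \in Zs & Z x).
Proof.
move=> infG finFC ZsP cover.
pose Ys := [seq Z <- Zs | `[< proper_coset setT Z >]].
pose Ss := [seq Z <- Zs | `[< square_root_set Z >]].
have [|M [sM _ fiM smM]] := @proper_coset_small setT Ys subgroupT.
  by move=> Z; rewrite mem_filter => /andP[/asboolP].
have infM : infinite_set M.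
  by rewrite -[M]setTI; exact: fin_index_infinite.
(* One element more than there are square-root sets, for the pigeonhole at the end. *)
have [hs [Uhs shs hsM hsFC]] := FC_transversal (size Ss).+1 infM finFC.
(* A point of [M] outside [T] must lie in a member of [Ss]. *)
pose T := [set 1] `|` \bigcup_(Z in [set` Ys]) (M `&` Z).
have smT : small setT T by exact: smallU (small1 infG) (small_bigcup smM).
pose W (p : G * G) := if p.1 == p.2 then set0 else
  \bigcup_(Z in [set` Ss]) [set x | Z (p.1 * x) /\ Z (p.2 * x)].
have smW : {in [seq (h, k) | h <- hs, k <- hs], forall p, small setT (W p)}.
  move=> _ /allpairsP[[h k] /= [hhs khs ->]]; rewrite /W /=.
  case: ifPn => [_|hk]; first exact: small0.
  apply: small_bigcup => Z; rewrite mem_filter => /andP[/asboolP sqZ _].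
  by apply: square_root_set_small => //; exact: hsFC.
have smV : {in hs, forall h, small setT [set x | T (h * x)]}.
  by move=> h _; exact: small_translate.
apply: (small_fin_index subgroupT fiM).
apply: small_sub (smallU (small_bigcup smV) (small_bigcup smW)) => x Mx.
apply: contrapT => /not_orP[nV nW].
(* The implication sits under the quantifier so that [choice] yields a total [f]; [set0] is a dummy
   value off [hs]. *)
have hS h : exists Z, h \in hs -> Z \in Ss /\ Z (h * x).
  have [hhs|_] := boolP (h \in hs); last by exists set0.
  have nT : ~ T (h * x) by move=> Thx; apply: nV; exists h.
  have [|Z ZZs Zhx] := cover (h * x); first by move=> hx1; apply: nT; left.
  exists Z => _; split=> //; rewrite mem_filter ZZs andbT; apply/asboolP.
  have [pZ|//] := ZsP Z ZZs; case: nT; right; exists Z.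
    by rewrite /= mem_filter ZZs andbT; apply/asboolP.
  by split=> //; apply: subgroupM => //; exact: hsM.
have [f fP] := choice hS.
(* A collision [f h = f k] with [h != k] would put [x] in [W (h, k)]. *)
have finj : {in hs &, injective f}.
  move=> h k hhs khs fhk; apply: contrapT => /eqP/negPf hk; apply: nW.
  exists (h, k); first by apply/allpairsP; exists (h, k).
  rewrite /W /= hk; have [fS fx] := fP h hhs.
  by exists (f h) => //=; split=> //; rewrite fhk; exact: (fP k khs).2.
have : (size (map f hs) <= size Ss)%N.
  apply: uniq_leq_size; first by rewrite map_inj_in_uniq.
  by move=> _ /mapP[h hhs ->]; exact: (fP h hhs).1.
by rewrite size_map shs ltnn.
Qed.

Lemma no_cover (Zs : seq (set G)) : infinite_set [set: G] ->
  {in Zs, forall Z, proper_coset setT Z \/ square_root_set Z} ->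
  ~ (forall x, x <> 1 -> exists2 Z, Z \in Zs & Z x).
Proof.
move=> infG; have [finFC|infFC] := pselect (finite_set FC).
  exact: no_FC_cover.
by have [L [sL infL cL]] := FC_infinite_abelian infFC; exact: no_abelian_cover cL.
Qed.

End Subgroups.

(** * Zero sets of monomials of degree at most 2 *)

Section ZeroSets.
Variable G : groupType.
Implicit Types (a b c d e g x y : G) (w : gpoly G) (Z : set G).

Lemma proper_coset_subsingleton Z :
  (forall x y, Z x -> Z y -> x = y) -> ~ Z 1 -> proper_coset setT Z.
Proof.
move=> Zxy Z1; exists [set 1]; split=> [|x y _ _ Zx Zy|x _ Zx /= x1].
- exact: subgroup1.
- by rewrite (Zxy x y Zx Zy) /= mulVg.
- by apply: Z1; rewrite -x1.
Qed.

(** The elements conjugating [d] to [e] fill a coset of the centralizer of [d]. If one of them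
    centralized [d], then [d = e] and 1 would be in [Z]. *)
Lemma proper_coset_conjugators d e Z :
  (forall x, Z x <-> x * d = e * x) -> ~ Z 1 -> proper_coset setT Z.
Proof.
move=> ZP Z1; exists (cent [set d]); split=> [|x y _ _|x _].
- exact: subgroup_cent.
- by move=> /ZP xd /ZP yd; apply/cent1P; exact: commute_conjugators yd.
- move=> /ZP xd /cent1P; rewrite /commute xd => /mulIg ed.
  by apply/Z1/ZP; rewrite ed mulg1 mul1g.
Qed.

Lemma square_root_setP b c Z :
  (forall x, Z x <-> x * b * x = c) -> ~ Z 1 -> square_root_set Z.
Proof.
move=> ZP Z1; exists b, c; split=> [bc|x /ZP//].
by apply/Z1/ZP; rewrite mulg1 mul1g.
Qed.

Lemma gevalMXC g w a : geval g (w * gX G * gconst a) = geval g w * g * a.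
Proof. by rewrite !gmulfM /= geval_X geval_const. Qed.

Lemma gevalMVC g w a : geval g (w * (gX G)^-1 * gconst a) = geval g w * g^-1 * a.
Proof. by rewrite !gmulfM gmulfV /= geval_X geval_const. Qed.

Lemma monomials1P w : monomials G 1 w -> exists a b,
  [\/ forall g, geval g w = a, forall g, geval g w = a * g * b |
      forall g, geval g w = a * g^-1 * b].
Proof.
move=> [[[a _ <-]|[_ [a _ <-] [b _ <-]]]|[_ [a _ <-] [b _ <-]]].
- by exists a, 1; apply: Or31 => g; rewrite geval_const.
- by exists a, b; apply: Or32 => g; rewrite gevalMXC geval_const.
- by exists a, b; apply: Or33 => g; rewrite gevalMVC geval_const.
Qed.

Lemma mul3_eq1 a x c : a * x * c = 1 <-> x = a^-1 * c^-1.
Proof.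
split=> [e|->]; last by rewrite mulgA mulgV mul1g mulVg.
by apply: (@mulgI _ a); apply: (@mulIg _ c); rewrite e mulVKg mulVg.
Qed.

(** In degree 2, opposite exponents of [x] give a conjugacy equation and equal exponents a
    square-root equation, after inversion if both are -1. In lower degree there is at most one
    zero. *)
Lemma zero_set_class w : monomials G 2 w -> geval 1 w <> 1 ->
  let Z := [set g | geval g w = 1] in proper_coset setT Z \/ square_root_set Z.
Proof.
move=> w2 w1 Z; have Z1 : ~ Z 1 by [].
have coset : (forall x y, Z x -> Z y -> x = y) ->
    proper_coset setT Z \/ square_root_set Z.
  by left; exact: proper_coset_subsingleton.
case: w2 => [[/monomials1P[a [b [] E]]|]|].
- by apply: coset => x y; rewrite /Z /= E => a1; case: w1; rewrite E.
- apply: coset => x y; rewrite /Z /= !E.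
  by move=> /mul3_eq1 -> /mul3_eq1 ->.
- apply: coset => x y; rewrite /Z /= !E.
  by move=> /mul3_eq1 ex /mul3_eq1 ey; apply: invg_inj; rewrite ex ey.
- move=> [v /monomials1P[a [b [] E]] [c _ wE]].
  + apply: coset => x y; rewrite /Z /= -wE !gevalMXC !E.
    by move=> /mul3_eq1 -> /mul3_eq1 ->.
  + right; apply: (@square_root_setP b (a^-1 * c^-1)) => // x.
    rewrite -mul3_eq1 /Z /= -wE gevalMXC E !mulgA; reflexivity.
  + left; apply: (@proper_coset_conjugators (a^-1 * c^-1) b) => // x.
    rewrite /Z /= -wE gevalMXC E.
    rewrite -[a * _ * b]mulgA -[a * _ * x]mulgA mul3_eq1.
    by split=> [<-|e]; [rewrite !mulgA mulgV mul1g|rewrite -mulgA -e mulKg].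
- move=> [v /monomials1P[a [b [] E]] [c _ wE]].
  + apply: coset => x y; rewrite /Z /= -wE !gevalMVC !E.
    by move=> /mul3_eq1 ex /mul3_eq1 ey; apply: invg_inj; rewrite ex ey.
  + left; apply: (@proper_coset_conjugators b (a^-1 * c^-1)) => // x.
    rewrite /Z /= -wE gevalMVC E.
    rewrite -[a * _ * b]mulgA -[a * _ * x^-1]mulgA mul3_eq1.
    by split=> [<-|->]; rewrite ?mulgVK ?mulgK.
  + right; apply: (@square_root_setP b^-1 (a^-1 * c^-1)^-1) => // x.
    rewrite /Z /= -wE gevalMVC E.
    rewrite -[a * _ * b]mulgA -[a * _ * x^-1]mulgA mul3_eq1.
    by split=> [<-|e]; [|apply: invg_inj; rewrite -e]; rewrite !invgM !invgK mulgA.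
Qed.

End ZeroSets.

Theorem theorem1 (G : groupType) (G_infinite : infinite_set [set: G]) :
  ~ (forall A : set (zariski (monomials G 2)), open A).
Proof.
move=> /(_ [set 1]) [D sD D1].
have [B DB B1] : exists2 B, D B & B 1.
  have : [set 1] (1 : G) by [].
  by rewrite -[X in X _]D1 => -[B DB B1]; exists B.
have BU : B `<=` [set 1] by rewrite -D1; exact: bigcup_sup.
(* The basic open set [B] is a finite intersection of co-zero sets and equals the singleton of 1, so
   the zero sets of the [w] in [ws] cover all other points. *)
have [ws wsD wsB] := sD B DB.
apply: (@no_cover G [seq [set g | geval g w = 1] | w <- enum_fset ws] G_infinite).
  move=> _ /mapP[w wws ->]; apply: zero_set_class.
    by have := wsD w wws; rewrite inE.
  by move: B1; rewrite -wsB; apply.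
move=> x x1; apply: contrapT => nx; apply/x1/BU; rewrite -wsB => w wws /= xw.
by apply: nx; exists [set g | geval g w = 1] => //; apply: map_f.
Qed.
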